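(* Let $n$ be a positive integer with prime factorization $n = \prod_{j=1}^{s} p_j^{\nu_{p_j}(n)}$, where $p_1,\dots,p_s$ are the distinct primes dividing $n$. Then $$\nu_2(\sigma(n)) = \sum_{\substack{1\le i\le s\\ \nu_{p_i}(n)\ \text{odd}\\ p_i\ \text{odd}}} \nu_2\left(\frac{(\nu_{p_i}(n)+1)(p_i+1)}{2}\right).$$
   Context: For a prime $p$ and a positive integer $m$, $\nu_p(m)$ denotes the $p$-adic valuation of $m$, i.e. the exponent of the highest power of $p$ dividing $m$. $\sigma(n)$ denotes the sum of the positive divisors of $n$. An empty sum is $0$. *)

(* Defs.v *)
From mathcomp Require Import all_boot.

Set Implicit Arguments.
Unset Strict Implicit.
Unset Printing Implicit Defensive.

Definition sigma (n : nat) : nat := \sum_(d <- divisors n) d.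

(* Main.v *)
(** Since sigma is multiplicative over coprime factors, only the factors
    [sigma (p ^ k) = 1 + p + ... + p ^ k] matter. Such a factor is odd if [p = 2]
    or [k] is even. If [p] is odd and [k + 1 = 2m], it equals [(1 + p)] times the
    geometric sum of length [m] and ratio [q = p ^ 2], and [q = 1 %[mod 4]]. For
    such a ratio, a geometric sum has the same 2-adic valuation as its length: a
    sum of odd length is odd, and halving an even length replaces [q] by [q ^ 2]
    and splits off the factor [1 + q], which is 2 modulo 4. *)
Require Import Defs.
From mathcomp Require Import all_boot.

Set Implicit Arguments.
Unset Strict Implicit.
Unset Printing Implicit Defensive.

(** Coprimality lets both factors be recovered from the product: if [d] divides [m] and [e] divides
    [n], then [gcdn m (d * e) = d] and [gcdn n (d * e) = e]. Conversely, a divisor [d] of [m * n] is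
    the product of [gcdn d m] and [gcdn d n]. *)
Lemma divisorsM (m n : nat) :
  0 < m -> 0 < n -> coprime m n ->
  perm_eq (divisors (m * n)) [seq d * e | d <- divisors m, e <- divisors n].
Proof.
move=> m_gt0 n_gt0 co_mn.
have mn_gt0 : 0 < m * n by rewrite muln_gt0 m_gt0.
apply: uniq_perm; first exact: divisors_uniq.
- apply: allpairs_uniq; try exact: divisors_uniq.
  move=> _ _ /allpairsP[[a b] /= [am bn ->]] /allpairsP[[c d] /= [cm dn ->]] /=.
  move: am bn cm dn; rewrite -!dvdn_divisors // => am bn cm dn eq_ab_cd.
  have gcd_l x y : x %| m -> y %| n -> gcdn m (x * y) = x.
    move=> xm yn; rewrite Gauss_gcdl; first exact/gcdn_idPr.
    exact: coprime_dvdr yn co_mn.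
  have gcd_r x y : x %| m -> y %| n -> gcdn n (x * y) = y.
    move=> xm yn; rewrite Gauss_gcdr; first exact/gcdn_idPr.
    by apply: (coprime_dvdr xm); rewrite coprime_sym.
  by congr pair; [rewrite -(gcd_l a b) // eq_ab_cd gcd_l
                 | rewrite -(gcd_r a b) // eq_ab_cd gcd_r].
move=> d; rewrite -dvdn_divisors //; apply/idP/allpairsP => [dmn | [[a b] /=]].
- exists (gcdn d m, gcdn d n); rewrite /= -!dvdn_divisors // !dvdn_gcdr.
  split=> //; apply/eqP; rewrite eqn_dvd; apply/andP; split.
    rewrite muln_gcdr !muln_gcdl !dvdn_gcd dmn.
    by rewrite dvdn_mulr // dvdn_mull // dvdn_mulr.
  rewrite Gauss_dvd ?dvdn_gcdl //.
  by apply: coprime_dvdl (dvdn_gcdr d m) _; apply: coprime_dvdr (dvdn_gcdr d n) _.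
- by rewrite -!dvdn_divisors // => -[am bn ->]; apply: dvdn_mul.
Qed.

Lemma sigmaM (m n : nat) :
  0 < m -> 0 < n -> coprime m n -> sigma (m * n) = sigma m * sigma n.
Proof.
move=> m_gt0 n_gt0 co_mn.
rewrite /sigma (perm_big _ (divisorsM m_gt0 n_gt0 co_mn)) /=.
by rewrite big_allpairs_dep big_distrlr.
Qed.

Lemma sigma_pfactor (p k : nat) :
  prime p -> sigma (p ^ k) = \sum_(i < k.+1) p ^ i.
Proof.
move=> p_pr; have p_gt1 := prime_gt1 p_pr.
have pk_gt0 : 0 < p ^ k by rewrite expn_gt0 prime_gt0.
rewrite -(big_mkord xpredT (expn p)) -(big_map (expn p) xpredT id).
apply: perm_big; apply: uniq_perm; first exact: divisors_uniq.
  by rewrite map_inj_uniq ?iota_uniq //; apply: expnI.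
move=> d; rewrite -dvdn_divisors //.
apply/(dvdn_pfactor _ _ p_pr)/mapP => [[i le_ik ->] | [i]].
  by exists i; rewrite // mem_index_iota.
by rewrite mem_index_iota ltnS => le_ik ->; exists i.
Qed.

Lemma sigma_gt0 (n : nat) : 0 < n -> 0 < sigma n.
Proof.
move=> n_gt0; rewrite /sigma (bigD1_seq n) ?divisors_uniq ?divisors_id //=.
by rewrite addn_gt0 n_gt0.
Qed.

Lemma primesMX (p k m : nat) :
  prime p -> 0 < k -> 0 < m -> coprime p m ->
  perm_eq (primes (m * p ^ k)) (p :: primes m).
Proof.
move=> p_pr k_gt0 m_gt0 co_pm.
apply: uniq_perm; rewrite /= ?primes_uniq // ?andbT.
  by rewrite mem_primes negb_and p_pr /= m_gt0 -prime_coprime.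
have pk_gt0 : 0 < p ^ k by rewrite expn_gt0 prime_gt0.
move=> q; rewrite primesM // primesX // (primes_prime p_pr) //.
by rewrite !inE orbC.
Qed.

(** The terms of exponents [2i] and [2i + 1] add up to [(1 + q) * q ^ (2i)]. *)
Lemma sum_expn_double (q m : nat) :
  \sum_(i < m.*2) q ^ i = q.+1 * \sum_(i < m) (q ^ 2) ^ i.
Proof.
elim: m => [|m IHm]; first by rewrite !big_ord0 muln0.
rewrite doubleS !big_ord_recr /= IHm mulnDr -addnA -expnM mul2n; congr (_ + _).
by rewrite mulSn expnS.
Qed.

Lemma odd_sum_expn (q m : nat) : odd q -> odd (\sum_(i < m) q ^ i) = odd m.
Proof.
move=> q_odd; elim: m => [|m IHm]; first by rewrite big_ord0.
by rewrite big_ord_recr /= oddD IHm oddX q_odd orbT addbT.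
Qed.

Lemma logn2_odd (m : nat) : odd m -> logn 2 m = 0.
Proof. by rewrite -coprime2n; apply: logn_coprime. Qed.

Lemma modn4_odd (q : nat) : q = 1 %[mod 4] -> odd q.
Proof. by move=> q1; rewrite (divn_eq q 4) q1 oddD oddM andbF. Qed.

Lemma sum_expn_gt0 (q m : nat) : 0 < m -> 0 < \sum_(i < m) q ^ i.
Proof. by case: m => // m _; rewrite big_ord_recl expn0. Qed.

Lemma logn2_sum_expn (q m : nat) :
  q = 1 %[mod 4] -> logn 2 (\sum_(i < m) q ^ i) = logn 2 m.
Proof.
(* The ratio [q] stays general in the induction, since halving [m] squares it. *)
elim/ltn_ind: m q => m IHm q q1; have q_odd := modn4_odd q1.
have [m_odd | m_even] := boolP (odd m).
  by rewrite !logn2_odd ?odd_sum_expn.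
(* The even length 0 is set apart because halving does not decrease it. *)
have [-> | m_gt0] := posnP m; first by rewrite big_ord0.
have def_m : m = m./2.*2 by rewrite even_halfK.
have h_gt0 : 0 < m./2 by rewrite -double_gt0 -def_m.
have q2_1 : q ^ 2 = 1 %[mod 4] by rewrite -modnXm q1.
(* With [q = 4a + 1], [q + 1 = 2 * (2a + 1)] and the second factor is odd. *)
have vq : logn 2 q.+1 = 1.
  have -> : q.+1 = 2 * (q %/ 4 * 2).+1.
    by rewrite {1}(divn_eq q 4) q1 -addnS [RHS]mulnS [RHS]addnC [in RHS]mulnCA.
  by rewrite lognM // logn_prime // logn2_odd //= oddM andbF.
rewrite [in LHS]def_m sum_expn_double lognM ?sum_expn_gt0 // vq IHm //.
  by rewrite [in RHS]def_m -mul2n lognM.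
by rewrite [in X in _ < X]def_m -addnn -[X in X < _]addn0 ltn_add2l.
Qed.

Lemma logn2_sigma_pfactor (p k : nat) :
  prime p ->
  logn 2 (sigma (p ^ k)) =
    if odd k && odd p then logn 2 ((k.+1 * p.+1) %/ 2) else 0.
Proof.
move=> p_pr; rewrite sigma_pfactor //.
have [p_odd | p_even] := boolP (odd p); last first.
  (* Every term except [p ^ 0 = 1] is even, so the sum is odd. *)
  rewrite andbF logn2_odd // big_ord_recl oddD expn0 big_seq /=.
  elim/big_ind: _ => // [x y|i _]; last by rewrite oddX (negPf p_even).
  by rewrite oddD => /negPf-> /negPf->.
have [k_odd /= | k_even] := boolP (odd k); last first.
  by rewrite logn2_odd // odd_sum_expn.
have def_k : k.+1 = k.+1./2.*2 by rewrite even_halfK //= k_odd.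
have h_gt0 : 0 < k.+1./2 by rewrite -double_gt0 -def_k.
(* The residue of [p] modulo 4 is 1 or 3, and both square to 1. *)
have p2_1 : p ^ 2 = 1 %[mod 4].
  rewrite -modnXm; have: odd (p %% 4) by rewrite odd_mod.
  by have := ltn_pmod p (isT : 0 < 4); case: (p %% 4) => [|[|[|[|]]]].
rewrite [in LHS]def_k sum_expn_double lognM ?sum_expn_gt0 // logn2_sum_expn //.
(* Since [k + 1] is twice [k.+1./2], the division by 2 is exact and leaves [k.+1./2 * p.+1]. *)
by rewrite [in RHS]def_k -mul2n -mulnA mulKn // lognM // addnC.
Qed.

Theorem theorem1p1 (n : nat) (n_gt0 : 0 < n) :
  logn 2 (sigma n) =
    \sum_(p <- primes n | odd (logn p n) && odd p)
      logn 2 (((logn p n).+1 * p.+1) %/ 2).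
Proof.
elim/ltn_ind: n n_gt0 => n IHn n_gt0.
have [n_le1 | n_gt1] := leqP n 1.
  have -> : n = 1 by apply/eqP; rewrite eqn_leq n_le1.
  by rewrite big_nil /sigma big_seq1.
(* The induction splits off the full power of the smallest prime factor. *)
set p := pdiv n; have p_pr : prime p by apply: pdiv_prime.
have k_gt0 : 0 < logn p n by rewrite logn_gt0 mem_primes p_pr n_gt0 pdiv_dvd.
have [m co_pm def_n] := pfactor_coprime p_pr n_gt0.
move: (logn p n) k_gt0 def_n => k k_gt0 def_n.
have m_gt0 : 0 < m by move: n_gt0; rewrite def_n muln_gt0 => /andP[].
have pk_gt0 : 0 < p ^ k by rewrite expn_gt0 prime_gt0.
have co_pkm : coprime m (p ^ k) by rewrite coprime_sym coprimeXl.
have m_lt_n : m < n.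
  by rewrite def_n ltn_Pmulr // -(expn0 p) ltn_exp2l ?prime_gt1.
(* As [p] is defined from [n], it must become a plain variable before [n] is replaced by
   [m * p ^ k]. *)
move: p_pr co_pm def_n pk_gt0 co_pkm; move: p => p p_pr co_pm -> pk_gt0 co_pkm.
rewrite sigmaM // lognM ?sigma_gt0 // IHn // logn2_sigma_pfactor //.
rewrite (perm_big _ (primesMX p_pr k_gt0 m_gt0 co_pm)) /= big_cons.
have -> : logn p (m * p ^ k) = k by rewrite logn_Gauss ?pfactorK.
(* Membership in [primes m] is recorded in the range because it makes [q] coprime to [p], so that
   [p ^ k] does not affect the valuation at [q]. *)
rewrite [in LHS]big_seq_cond [in RHS]big_seq_cond.
have logn_q q : q \in primes m -> logn q (m * p ^ k) = logn q m.
  move=> q_m; rewrite mulnC logn_Gauss //; apply: coprimeXr.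
  move: q_m; rewrite mem_primes => /and3P[_ _ q_m].
  by rewrite coprime_sym; apply: coprime_dvdr q_m co_pm.
have -> : \sum_(q <- primes m | (q \in primes m)
              && (odd (logn q (m * p ^ k)) && odd q))
            logn 2 (((logn q (m * p ^ k)).+1 * q.+1) %/ 2)
        = \sum_(q <- primes m | (q \in primes m) && (odd (logn q m) && odd q))
            logn 2 (((logn q m).+1 * q.+1) %/ 2).
  apply: eq_big => [q | q /andP[q_m _]]; last by rewrite logn_q.
  by have [q_m | //] := boolP (q \in primes m); rewrite logn_q.
by case: ifP => _; rewrite addnC.
Qed.
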